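(* Let $\psi$ be a neighbor function with associated distance parameters $\sigma_1,\dots,\sigma_m$, let $\mu>0$, and let $Q_{\langle G,A_i\rangle}$ be a group-by sum query over confidential attribute $A_i$. Then the neighbor mechanism $M_\psi$, defined by $M_\psi(D)=\psi\big(Q_{\langle G,A_i\rangle}(D)\big)+N\big(\mathbf{0},\tfrac{\sigma_i^2}{\mu^2}\mathbf{I}\big)$ ($\psi$ applied to each entry of the query answer, and independent Gaussian noise of variance $\sigma_i^2/\mu^2$ added to each entry), satisfies $\mu$-Gaussian Establishment DP with neighbor function $\psi$ and distance parameters $\sigma_1,\dots,\sigma_m$.
   Context: A neighbor function is a function $\psi:\mathbb{R}_{\geq 0}\to\mathbb{R}$ that is strictly increasing, continuous, concave, and such that $x\mapsto\psi(e^{x})$ is convex. An establishment record is a tuple $r=(a_1,\dots,a_p,c_1,\dots,c_m)$ of public attribute values $a_1,\dots,a_p$ (of attributes $P_1,\dots,P_p$) and nonnegative real confidential attribute values $c_1,\dots,c_m$ (of attributes $A_1,\dots,A_m$); write $r[A_j]=c_j$. A dataset is a finite collection of records, one per establishment. Given nonnegative distance parameters $\sigma_1,\dots,\sigma_m$, a record $r$ is $\psi$-close to $r'$ if their public attribute values coincide and $|\psi(r[A_j])-\psi(r'[A_j])|\leq\sigma_j$ for all $j=1,\dots,m$. Datasets $D_1,D_2$ are $\psi$-neighbors if $D_1$ is obtained from $D_2$ by replacing one record $r$ with a record $r'$ that is $\psi$-close to $r$. A randomized mechanism $M$ satisfies $\mu$-Gaussian Establishment DP (with $\psi$ and $\sigma_1,\dots,\sigma_m$)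 if for all pairs of $\psi$-neighbors $D_1,D_2$ and all (measurable) sets $S$, $\Phi^{-1}(P(M(D_2)\in S))\leq\Phi^{-1}(P(M(D_1)\in S))+\mu$, where $\Phi$ is the standard normal CDF. A group-by sum query $Q_{\langle G,A_i\rangle}$ is given by a function $G$ of a record's public attribute values into a finite set of groups; its answer is the vector, indexed by the groups $g$, whose entry for $g$ is $\sum_{r\in D:\,G(r)=g} r[A_i]$. *)

(* Defs.v *)
From HB Require Import structures.
From mathcomp Require Import all_boot all_order all_algebra.
From mathcomp Require Import all_classical all_reals all_analysis.
From mathcomp Require Import normal_distribution.
Set Implicit Arguments. Unset Strict Implicit. Unset Printing Implicit Defensive.
Import Order.TTheory GRing.Theory Num.Theory.
Import numFieldNormedType.Exports.
Local Open Scope classical_set_scope.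
Local Open Scope ring_scope.

Section Defs.
Variable R : realType.

Definition neighbor_function (psi : R -> R) : Prop :=
  [/\ (forall x y : R, 0 <= x -> x < y -> psi x < psi y),
      {within [set x : R | 0 <= x], continuous psi},
      (forall (x y t : R), 0 <= x -> 0 <= y -> 0 <= t <= 1 ->
          t * psi x + (1 - t) * psi y <= psi (t * x + (1 - t) * y))
    & (forall (x y t : R), 0 <= t <= 1 ->
          psi (expR (t * x + (1 - t) * y)) <= t * psi (expR x) + (1 - t) * psi (expR y))].

Record record (Pub : Type) (m : nat) := Record_ {
  pub : Pub;
  conf : 'I_m -> R;
  conf_ge0 : forall j, 0 <= conf j }.

Definition dataset (Pub : Type) (m : nat) := seq (record Pub m).

Definition psi_close (Pub : Type) (m : nat) (psi : R -> R) (sigma : 'I_m -> R)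
  (r r' : record Pub m) : Prop :=
  pub r = pub r' /\ forall j, `|psi (conf r j) - psi (conf r' j)| <= sigma j.

Definition psi_neighbors (Pub : Type) (m : nat) (psi : R -> R) (sigma : 'I_m -> R)
  (D1 D2 : dataset Pub m) : Prop :=
  exists (s1 s2 : dataset Pub m) (r r' : record Pub m),
    [/\ psi_close psi sigma r r', D2 = s1 ++ r :: s2 & D1 = s1 ++ r' :: s2].

Definition groupby_sum (Pub : Type) (m : nat) (Gr : finType) (G : Pub -> Gr)
  (i : 'I_m) (D : dataset Pub m) : Gr -> R :=
  fun g => \sum_(r <- D | G (pub r) == g) conf r i.

(* standard normal CDF and its (extended-real valued) inverse;
   Phi_inv 0 = -oo, Phi_inv 1 = +oo *)
Definition Phi (x : R) : R := fine (normal_prob 0 1 `]-oo, x]).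
Definition Phi_inv (p : R) : \bar R :=
  ereal_inf [set (x%:E) | x in [set x : R | p <= Phi x]].

(* sigma-algebra on the output space Gr -> R (= R^#|Gr|): product Borel
   sigma-algebra, generated by the coordinate projections *)
Definition out_measurable (Gr : finType) : set (set (Gr -> R)) :=
  <<s \bigcup_(g in [set: Gr])
        [set (fun f : Gr -> R => f g) @^-1` A | A in [set A : set R | measurable A]] >>.

Definition mutually_independent (d : measure_display) (Omega : measurableType d)
  (P : probability Omega R) (Gr : finType) (W : Gr -> Omega -> R) : Prop :=
  forall (J : {set Gr}) (A : Gr -> set R), (forall g, measurable (A g)) ->
    P (\bigcap_(g in [set g | g \in J]) (W g @^-1` A g)) =
    (\prod_(g in J) P (W g @^-1` A g))%E.

Definition gaussian_establishment_DP (d : measure_display) (Omega : measurableType d)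
  (P : probability Omega R) (Pub : Type) (m : nat) (Gr : finType)
  (psi : R -> R) (sigma : 'I_m -> R) (mu : R)
  (M : dataset Pub m -> Omega -> (Gr -> R)) : Prop :=
  forall D1 D2 : dataset Pub m, psi_neighbors psi sigma D1 D2 ->
  forall S : set (Gr -> R), @out_measurable Gr S ->
    (Phi_inv (fine (P (M D2 @^-1` S))) <=
     Phi_inv (fine (P (M D1 @^-1` S))) + mu%:E)%E.

End Defs.

(* Main.v *)
(* Concavity makes the increments of [psi] shrink to the right, so psi-close
   records move [psi] of a group sum by at most [sigma i], and only in the
   coordinate of their common group.  Rescaling by [sigma i / mu], the two
   outputs differ by a shift [h] of one coordinate of a standard Gaussian
   vector, with [|h| <= mu].  The shifted law has density
   [exp (h x - h^2 / 2)] with respect to the original one, a monotone function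
   of that coordinate, so by the Neyman-Pearson argument half-lines are the
   extremal events: [P(M(D1) in S) <= Phi x] implies
   [P(M(D2) in S) <= Phi (x + |h|)]. *)

Require Import Defs.
From HB Require Import structures.
From mathcomp Require Import all_boot all_order all_algebra.
From mathcomp Require Import all_classical all_reals all_analysis.
From mathcomp Require Import measurable_realfun normal_distribution.
From mathcomp Require Import ring lra.
Import Order.TTheory GRing.Theory Num.Theory.
Import numFieldNormedType.Exports.
Local Open Scope classical_set_scope.
Local Open Scope ring_scope.

(** * Shifts and reflections of the standard Gaussian law *)

Lemma lebesgue_measure_shift (R : realType) (h : R) (A : set R) :
  measurable A ->
  pushforward lebesgue_measure ((fun x => x + h) : _ -> measurableTypeR R) A =
  lebesgue_measure A.
Proof.
move=> mA; apply/esym/lebesgue_measure_unique => //=.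
  exact: measurable_funD.
move=> ? _ [[a b]] _ <-.
rewrite /pushforward /=.
have -> : (fun x => x + h) @^-1` `]a, b]%classic = `]a - h, b - h]%classic.
  by apply/seteqP; split => x /=; rewrite !in_itv /= ltrBlDr lerBrDr.
rewrite !lebesgue_measure_itv /= !lte_fin ltrD2r; case: ifP => // _.
by rewrite -!EFinB; congr EFin; ring.
Qed.

(** Expanding the square in the exponent; the exponential factor is the likelihood ratio of
    [N(h, 1)] to [N(0, 1)]. *)
Lemma normal_pdf01_shift (R : realType) (h x : R) :
  normal_pdf 0 1 (x - h) = normal_pdf 0 1 x * expR (h * x - h ^+ 2 / 2) :> R.
Proof.
rewrite !normal_pdfE ?oner_eq0 // -mulrA; congr (_ * _).
rewrite /normal_fun -expRD; congr expR.
by rewrite expr1n !subr0; field.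
Qed.

Lemma normal_prob01_shift (R : realType) (h : R) (A : set R) : measurable A ->
  normal_prob 0 1 ((fun x => x + h) @^-1` A) =
  (\int[lebesgue_measure]_(x in A)
    ((expR (h * x - h ^+ 2 / 2))%:E * (normal_pdf 0 1 x)%:E))%E.
Proof.
move=> mA; rewrite /normal_prob.
have ms : @measurable_fun _ _ (measurableTypeR R) (measurableTypeR R)
  setT (fun x => x + h) by exact: measurable_funD.
rewrite [LHS](_ : _ = \int[lebesgue_measure]_(x in
   ((fun x => x + h)%R : R -> measurableTypeR R) @^-1` A)
   ((fun y => (normal_pdf 0 1 (y - h))%:E) \o (fun x => x + h)%R) x)%E; last first.
  by apply: eq_integral => x _ /=; rewrite addrK.
rewrite -(ge0_integral_pushforward ms) //=; last 2 first.
- apply/measurable_funTS/measurable_EFinP.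
  apply: measurableT_comp; first exact: measurable_normal_pdf.
  exact: measurable_funB.
- by move=> y _; rewrite lee_fin normal_pdf_ge0.
rewrite (@eq_measure_integral _ _ _ _ lebesgue_measure); last first.
  by move=> B mB _; exact: lebesgue_measure_shift.
by apply: eq_integral => x _; rewrite normal_pdf01_shift mulrC EFinM.
Qed.

Lemma normal_pdf01_opp (R : realType) (x : R) :
  normal_pdf 0 1 (- x) = normal_pdf 0 1 x :> R.
Proof.
by rewrite !normal_pdfE ?oner_eq0 // /normal_fun !subr0 sqrrN.
Qed.

Lemma normal_prob01_opp (R : realType) (A : set R) : measurable A ->
  normal_prob 0 1 (-%R @^-1` A) = normal_prob 0 1 A.
Proof.
move=> mA; rewrite /normal_prob.
rewrite [LHS](_ : _ = \int[lebesgue_measure]_(x in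
   (-%R : R -> measurableTypeR R) @^-1` A)
   ((fun y => (normal_pdf 0 1 y)%:E) \o -%R) x)%E; last first.
  by apply: eq_integral => x _ /=; rewrite normal_pdf01_opp.
rewrite -ge0_integral_pushforward //=; last 2 first.
- apply: measurable_funTS; apply/measurable_EFinP; exact: measurable_normal_pdf.
- by move=> y _; rewrite lee_fin normal_pdf_ge0.
by apply: eq_measure_integral => B mB _; exact: lebesgue_measureN.
Qed.

(** * Exponential tilting of one Gaussian coordinate *)

(** The Radon-Nikodym derivative and [normal_pdf] have the same integral over every measurable set,
    hence agree almost everywhere. *)
Lemma ge0_integral_normal_prob (R : realType) (m s : R) (E : set R)
    (f : R -> \bar R) :
  (forall x, (0 <= f x)%E) -> measurable E -> measurable_fun E f ->
  (\int[normal_prob m s]_(x in E) f x =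
   \int[lebesgue_measure]_(x in E) (f x * (normal_pdf m s x)%:E))%E.
Proof.
move=> f0 mE mf.
have dom := @normal_prob_dominates R m s.
rewrite -(Radon_Nikodym_SigmaFinite.change_of_variables dom) //.
have mRN : measurable_fun E (Radon_Nikodym_SigmaFinite.f (normal_prob m s)
    lebesgue_measure).
  apply: measurable_funTS.
  exact: measurable_int (Radon_Nikodym_SigmaFinite.f_integrable dom).
have mpdf : measurable_fun E (fun x => (normal_pdf m s x)%:E).
  apply: measurable_funTS; apply/measurable_EFinP.
  exact: measurable_normal_pdf.
apply: ae_eq_integral => //; try exact: emeasurable_funM.
apply: ae_eqe_mul2l.
apply: integral_ae_eq => //.
  apply: (integrableS measurableT) => //.
  exact: Radon_Nikodym_SigmaFinite.f_integrable.
by move=> A AE mA; rewrite -Radon_Nikodym_SigmaFinite.f_integral.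
Qed.

(** The restricted measure gives no mass to the complement of [C] and agrees with [mu] inside [C].
    This moves an event from the domain of integration into the measure. *)
Lemma ge0_integral_mrestr (d : measure_display) (T : measurableType d)
    (R : realType) (mu : {measure set T -> \bar R}) (C D : set T)
    (mC : measurable C) (f : T -> \bar R) :
  measurable D -> measurable_fun D f -> (forall x, D x -> (0 <= f x)%E) ->
  (\int[mrestr mu mC]_(x in D) f x = \int[mu]_(x in C `&` D) f x)%E.
Proof.
move=> mD mf f0.
rewrite (@ge0_negligible_integral _ _ _ (mrestr mu mC) D (~` C)) //.
- rewrite setDE setCK setIC; apply: eq_measure_integral => A mA AD.
  by rewrite [LHS](_ : _ = mu (A `&` C)) // setIidl // => x /AD [].
- exact: measurableC.
- by rewrite [LHS](_ : _ = mu (~` C `&` C)) // setICl measure0.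
Qed.

(** By the product hypothesis, the image under [X] of [P] restricted to [C] is [P C] times the
    standard normal law, so both sides reduce to the same integral on the line. [C] stands for
    constraints on the other coordinates. *)
Lemma normal_tilt (d : measure_display) (T : measurableType d) (R : realType)
    (P : probability T R) (X : T -> R) (C : set T) (h : R) (A : set R) :
  measurable_fun setT X -> measurable C ->
  (forall B, measurable B ->
    P (C `&` X @^-1` B) = (P C * normal_prob 0 1 B)%E) ->
  measurable A ->
  P (C `&` [set w | A (X w + h)]) =
  (\int[P]_(w in C `&` X @^-1` A) (expR (h * X w - h ^+ 2 / 2))%:E)%E.
Proof.
move=> mX mC indep mA.
pose f (x : R) : \bar R := (expR (h * x - h ^+ 2 / 2))%:E.
have mf : measurable_fun setT f.
  apply/measurable_EFinP/measurableT_comp => //.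
  by apply: measurable_funB => //; exact: measurable_funM.
have f0 x : (0 <= f x)%E by rewrite lee_fin expR_ge0.
have mXA B : measurable B -> measurable (X @^-1` B).
  by move=> mB; rewrite -[X in measurable X]setTI; exact: mX.
rewrite (indep ((fun x => x + h) @^-1` A)); last first.
  by rewrite -[X in measurable X]setTI; apply: measurable_funD.
rewrite normal_prob01_shift //.
rewrite -(ge0_integral_normal_prob R 0 1 A f f0) //; last exact: measurable_funTS.
rewrite -(@ge0_integral_mrestr _ _ _ P C _ mC (f \o X)); first last.
- by move=> x _; exact: f0.
- exact/measurable_funTS/measurableT_comp.
- exact: mXA.
have mX' : @measurable_fun _ _ T (measurableTypeR R) setT X by exact: mX.
rewrite -(ge0_integral_pushforward mX') //; last exact: measurable_funTS.
have PC0 : 0 <= fine (P C) by rewrite fine_ge0.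
rewrite [RHS](@eq_measure_integral _ _ _ _
  (mscale (NngNum PC0) (normal_prob 0 1))).
  rewrite ge0_integral_mscale //; last exact: measurable_funTS.
  by rewrite /= fineK // fin_num_measure.
move=> B mB _.
rewrite [LHS](_ : _ = P (X @^-1` B `&` C)) // setIC indep //.
rewrite [RHS](_ : _ = ((fine (P C))%:E * normal_prob 0 1 B)%E) //.
by rewrite fineK // fin_num_measure.
Qed.

(** Independence is used for all coordinates and for all but [g0]; the two products differ by the
    factor of [g0]. *)
Lemma mutually_independent_split (d : measure_display) (T : measurableType d)
    (R : realType) (P : probability T R) (Gr : finType) (W : Gr -> T -> R)
    (g0 : Gr) (B : Gr -> set R) (A : set R) :
  mutually_independent P W -> (forall g, measurable (B g)) -> measurable A ->
  P ((\bigcap_(g in [set g | g != g0]) (W g @^-1` B g)) `&` W g0 @^-1` A) =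
  (P (\bigcap_(g in [set g | g != g0]) (W g @^-1` B g)) * P (W g0 @^-1` A))%E.
Proof.
move=> ind mB mA.
pose B' g := if g == g0 then A else B g.
have mB' g : measurable (B' g) by rewrite /B'; case: ifP.
have := ind finset.setT B' mB'.
have := ind (finset.setC (finset.set1 g0)) B mB.
rewrite (_ : [set g | g \in finset.setC _] = [set g | g != g0]); last first.
  by apply/seteqP; split => g /=; rewrite !finset.inE.
move=> -> PT.
rewrite (_ : _ `&` _ =
  \bigcap_(g in [set g | g \in finset.setT]) (W g @^-1` B' g)); last first.
  apply/seteqP; split => [w [wB wA] g _|w wB].
    by rewrite /= /B'; case: eqVneq => [->//|gg0]; exact: wB.
  split => [g /= gg0|].
    by have := wB g; rewrite /= /B' (negbTE gg0); apply; rewrite finset.inE.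
  by have := wB g0; rewrite /= /B' eqxx; apply; rewrite finset.inE.
rewrite PT (bigD1 g0) /=; last by rewrite finset.inE.
rewrite {1}/B' eqxx muleC; congr (_ * _)%E.
apply: eq_big => [g|g]; first by rewrite !finset.inE.
by rewrite /B' => /andP[_ /negbTE ->].
Qed.

(** * The product sigma-algebra and the density of the shifted vector *)

(** A pi-system for the output sigma-algebra, on which independence determines probabilities. *)
Definition rectangles (R : realType) (Gr : finType) : set (set (Gr -> R)) :=
  [set S | exists2 A : Gr -> set R, (forall g, measurable (A g)) &
     S = [set f | forall g, A g (f g)]].

Lemma rectangles_setI_closed (R : realType) (Gr : finType) :
  setI_closed (rectangles R Gr).
Proof.
move=> _ _ [A mA ->] [B mB ->].
exists (fun g => A g `&` B g); first by move=> g; exact: measurableI.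
apply/seteqP; split => f /=; first by move=> [fA fB] g.
by move=> fAB; split=> g; have [] := fAB g.
Qed.

Lemma out_measurable_rectangles (R : realType) (Gr : finType) :
  @out_measurable R Gr `<=` <<s rectangles R Gr >>.
Proof.
apply: smallest_sub; first exact: smallest_sigma_algebra.
move=> _ [g _ [A mA <-]]; apply: sub_sigma_algebra.
exists (fun g' => if g' == g then A else setT); first by move=> g'; case: ifP.
apply/seteqP; split => f /=; first by move=> fA g'; case: eqVneq => [->|].
by move=> /(_ g); rewrite eqxx.
Qed.

(** The sets with measurable preimage form a sigma-algebra; it contains each rectangle, whose
    preimage is a finite intersection. *)
Lemma measurable_preimage_rectangles (d : measure_display)
    (T : measurableType d) (R : realType) (Gr : finType) (F : T -> Gr -> R)
    (S : set (Gr -> R)) :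
  (forall g, measurable_fun setT (F ^~ g)) -> <<s rectangles R Gr >> S ->
  measurable (F @^-1` S).
Proof.
move=> mF; move: S.
apply: (@smallest_sub _ _ _ [set S | measurable (F @^-1` S)]).
  split => /=; first by rewrite preimage_set0.
    by move=> A mA; rewrite setTD preimage_setC; exact: measurableC.
  by move=> A mA; rewrite preimage_bigcup; exact: bigcup_measurable.
move=> _ [A mA ->] /=.
rewrite (_ : F @^-1` _ = \bigcap_(g in [set: Gr]) ((F ^~ g) @^-1` A g)).
  apply: fin_bigcap_measurable; first exact: finite_finset.
  by move=> g _; rewrite -[X in measurable X]setTI; exact: mF.
by apply/seteqP; split => w /= wA g; [move=> _|]; exact: wA.
Qed.

(* Pushing the [W g] through the maps [phi g] here, rather than replacing [S] by
   its preimage, avoids measurability of a map between products. *)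
Lemma gaussian_shift_density (d : measure_display) (T : measurableType d)
    (R : realType) (P : probability T R) (Gr : finType) (W : Gr -> T -> R)
    (phi : Gr -> R -> R) (g0 : Gr) (h : R) (S : set (Gr -> R)) :
  (forall g, measurable_fun setT (W g)) ->
  (forall g (A : set R), measurable A ->
    P (W g @^-1` A) = normal_prob 0 1 A) ->
  mutually_independent P W ->
  (forall g, measurable_fun setT (phi g)) ->
  <<s rectangles R Gr >> S ->
  P [set w | S (fun g => phi g (W g w + (if g == g0 then h else 0)))] =
  (\int[P]_(w in [set w | S (fun g => phi g (W g w))])
    (expR (h * W g0 w - h ^+ 2 / 2))%:E)%E.
Proof.
move=> mW lawW indW mphi.
pose F w g : R := phi g (W g w + (if g == g0 then h else 0)).
pose F0 w g : R := phi g (W g w).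
pose L w : \bar R := (expR (h * W g0 w - h ^+ 2 / 2))%:E.
have mL : measurable_fun setT L.
  apply/measurable_EFinP/measurableT_comp => //.
  by apply: measurable_funB => //; exact: measurable_funM.
have L0 w : (0 <= L w)%E by rewrite lee_fin expR_ge0.
have mF S' : <<s rectangles R Gr >> S' -> measurable (F @^-1` S').
  apply: measurable_preimage_rectangles => g.
  by apply: measurableT_comp; [exact: mphi|exact: measurable_funD].
have mF0 S' : <<s rectangles R Gr >> S' -> measurable (F0 @^-1` S').
  apply: measurable_preimage_rectangles => g.
  by apply: measurableT_comp; [exact: mphi|exact: mW].
(* Dynkin's pi-lambda argument: [Q] holds on rectangles and passes to complements and disjoint
   countable unions. *)
pose Q (S' : set (Gr -> R)) :=
  P (F @^-1` S') = (\int[P]_(w in F0 @^-1` S') L w)%E.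
have Qrect : rectangles R Gr `<=` Q.
  move=> _ [A mA ->].
  pose B g := phi g @^-1` A g.
  have mB g : measurable (B g) by rewrite -[X in measurable X]setTI; exact: mphi.
  (* [C] collects the constraints on the unshifted coordinates, which are the same for [F] and
     [F0]. *)
  pose C := \bigcap_(g in [set g | g != g0]) (W g @^-1` B g).
  have mC : measurable C.
    apply: fin_bigcap_measurable; first exact: finite_finset.
    by move=> g _; rewrite -[X in measurable X]setTI; exact: mW.
  rewrite /Q.
  rewrite (_ : F @^-1` _ = C `&` [set w | B g0 (W g0 w + h)]); last first.
    apply/seteqP; split => w /=.
      move=> wA; split; last by have := wA g0; rewrite /F eqxx.
      by move=> g /= gg0; have := wA g; rewrite /F (negbTE gg0) addr0.
    move=> [wC w0] g; rewrite /F; case: eqVneq => [->//|gg0].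
    by rewrite addr0; exact: wC.
  rewrite (_ : F0 @^-1` _ = C `&` W g0 @^-1` B g0); last first.
    apply/seteqP; split => w /=.
      by move=> wA; split => [g _|]; exact: wA.
    by move=> [wC w0] g; case: (eqVneq g g0) => [->//|gg0]; exact: wC.
  apply: normal_tilt => // B' mB'.
  by rewrite mutually_independent_split // lawW.
have QT : Q setT.
  by apply: Qrect; exists (fun=> setT) => //; apply/seteqP; split.
move=> sS; rewrite -/(Q S).
have := @dynkin_induction _ (g_sigma_algebraType (rectangles R Gr))
  (rectangles R Gr) Q erefl (@rectangles_setI_closed R Gr) QT Qrect.
apply => //.
- move=> S' mS' QS'.
  have mFS : measurable (F @^-1` S') by exact: mF.
  have mF0S : measurable (F0 @^-1` S') by exact: mF0.
  have PF : P (F @^-1` S') \is a fin_num by rewrite fin_num_measure.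
  suff : P (~` (F @^-1` S')) = (\int[P]_(w in ~` (F0 @^-1` S')) L w)%E by [].
  rewrite probability_setC //.
  (* The density has total mass one, so the complement follows by subtracting a term that is finite
     because it equals a probability. *)
  have : P setT = (\int[P]_(w in setT) L w)%E by exact: QT.
  rewrite probability_setT -(setUv (F0 @^-1` S')) ge0_integral_setU //=.
  - by move=> ->; rewrite -QS' [X in (X - _)%E]addeC addeK.
  - exact: measurableC.
  - exact: measurable_funTS.
  - exact/disj_setPRL.
- move=> G mG tG QG; rewrite /Q !preimage_bigcup.
  rewrite measure_semi_bigcup; first last.
  - by apply: bigcup_measurable => k _; exact: mF (mG k).
  - apply/trivIsetP => i j _ _ ij; rewrite -preimage_setI.
    by move/trivIsetP : tG => ->//; rewrite preimage_set0.
  - by move=> k; exact: mF (mG k).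
  rewrite ge0_integral_bigcup //.
  - by apply: eq_eseriesr => k _; exact: QG.
  - by move=> k; exact: mF0 (mG k).
  - exact: measurable_funTS.
  - apply/trivIsetP => i j _ _ ij; rewrite -preimage_setI.
    by move/trivIsetP : tG => ->//; rewrite preimage_set0.
Qed.

(** * Half-lines as extremal events *)

(** The part [E] shares with [B] cancels. What [E] has outside [B] carries density at most [k], what
    [B] has outside [E] at least [k], and the latter set has the larger measure. *)
Lemma neyman_pearson (d : measure_display) (T : measurableType d)
    (R : realType) (mu : {finite_measure set T -> \bar R}) (f : T -> R) (k : R)
    (E B : set T) :
  measurable_fun setT f -> (forall x, 0 <= f x) -> 0 <= k ->
  measurable E -> measurable B ->
  (forall x, B x -> k <= f x) -> (forall x, ~ B x -> f x <= k) ->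
  (mu E <= mu B)%E ->
  (\int[mu]_(x in E) (f x)%:E <= \int[mu]_(x in B) (f x)%:E)%E.
Proof.
move=> mf f0 k0 mE mB kf fk muEB.
have mg D : measurable_fun D (fun x => (f x)%:E).
  by apply: measurable_funTS; apply/measurable_EFinP.
have split_int A C : measurable A -> measurable C ->
    (\int[mu]_(x in A) (f x)%:E =
     \int[mu]_(x in A `&` C) (f x)%:E + \int[mu]_(x in A `\` C) (f x)%:E)%E.
  move=> mA mC; rewrite -ge0_integral_setU ?setUIDK //.
  - exact: measurableI.
  - exact: measurableD.
  - by move=> x _; rewrite lee_fin.
  - by apply/disj_setPRL => x [_ nC] [].
rewrite (split_int E B) // (split_int B E) // [B `&` E]setIC leeD2l //.
have mEB : measurable (E `\` B) by exact: measurableD.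
have mBE : measurable (B `\` E) by exact: measurableD.
apply: (@le_trans _ _ (\int[mu]_(x in E `\` B) k%:E)%E).
  apply: ge0_le_integral => //.
  - by move=> x _; rewrite lee_fin.
  - by move=> x [_ /fk]; rewrite lee_fin.
apply: (@le_trans _ _ (\int[mu]_(x in B `\` E) k%:E)%E); last first.
  apply: ge0_le_integral => //.
  by move=> x [/kf + _]; rewrite lee_fin.
rewrite !integral_cst // lee_wpmul2l ?lee_fin //.
move: muEB; rewrite (measureDI mu mE mB) (measureDI mu mB mE) [B `&` E]setIC.
by rewrite leeD2rE // fin_num_measure //; exact: measurableI.
Qed.

Lemma PhiE (R : realType) (x : R) : normal_prob 0 1 `]-oo, x] = (Phi x)%:E.
Proof. by rewrite /Phi fineK // fin_num_measure. Qed.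

Lemma Phi_sym (R : realType) (x : R) :
  normal_prob 0 1 `[- x, +oo[ = (Phi x)%:E.
Proof.
rewrite -PhiE -[RHS]normal_prob01_opp //; congr normal_prob.
by apply/seteqP; split => y /=; rewrite !in_itv /= andbT lerNl.
Qed.

Lemma Phi_nondecreasing (R : realType) (x y : R) : x <= y -> Phi x <= Phi y.
Proof.
move=> xy; rewrite -lee_fin -!PhiE; apply: le_measure; rewrite ?inE //.
by move=> z /=; rewrite !in_itv /= => /le_trans; apply.
Qed.

(** The density is monotone in [X], so its superlevel sets are half-lines: upper ones for [h >= 0],
    lower ones for [h < 0]. The half-line of mass [Phi x] in the right direction dominates [E], and
    its tilted mass is the Gaussian mass of the half-line moved by [h]. *)
Lemma normal_tilt_le (d : measure_display) (T : measurableType d)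
    (R : realType) (P : probability T R) (X : T -> R) (h x : R) (E : set T) :
  measurable_fun setT X ->
  (forall A, measurable A -> P (X @^-1` A) = normal_prob 0 1 A) ->
  measurable E -> fine (P E) <= Phi x ->
  (\int[P]_(w in E) (expR (h * X w - h ^+ 2 / 2))%:E <= (Phi (x + `|h|))%:E)%E.
Proof.
move=> mX lawX mE PEx.
have {}PEx : (P E <= (Phi x)%:E)%E.
  by rewrite -(fineK (fin_num_measure P E mE)) lee_fin.
have mpre A : measurable A -> measurable (X @^-1` A).
  by move=> mA; rewrite -[X in measurable X]setTI; exact: mX.
have tilt A : measurable A -> P [set w | A (X w + h)] =
    (\int[P]_(w in X @^-1` A) (expR (h * X w - h ^+ 2 / 2))%:E)%E.
  (* With the sure event for [C], the product hypothesis is just the law of [X]. *)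
  move=> mA; rewrite -[X in P X]setTI normal_tilt // ?setTI //.
  by move=> B mB; rewrite setTI probability_setT mul1e lawX.
have mL : measurable_fun setT (fun w => expR (h * X w - h ^+ 2 / 2)).
  apply: measurableT_comp => //.
  by apply: measurable_funB => //; exact: measurable_funM.
have L0 w : 0 <= expR (h * X w - h ^+ 2 / 2) by exact: expR_ge0.
have [h0|h0] := leP 0 h.
  rewrite ger0_norm // -Phi_sym -lawX //.
  have -> : X @^-1` `[- (x + h), +oo[ = [set w | `[- x, +oo[%classic (X w + h)].
    apply/seteqP; split => w /=; rewrite !in_itv /= !andbT; lra.
  rewrite tilt //.
  (* The threshold is the value of the density at the endpoint [- x] of the half-line. *)
  apply: (@neyman_pearson _ _ _ P _ (expR (h * (- x) - h ^+ 2 / 2))) => //.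
  - exact: mpre.
  - move=> w /=; rewrite in_itv /= andbT => xw.
    by rewrite ler_expR lerD2r ler_wpM2l.
  - move=> w /=; rewrite in_itv /= andbT => /negP; rewrite -ltNge => xw.
    by rewrite ler_expR lerD2r ler_wpM2l // ltW.
  - by apply: (le_trans PEx); rewrite -Phi_sym -lawX.
rewrite ltr0_norm // -PhiE -lawX //.
have -> : X @^-1` `]-oo, x - h] = [set w | `]-oo, x]%classic (X w + h)].
  apply/seteqP; split => w /=; rewrite !in_itv /=; lra.
rewrite tilt //.
apply: (@neyman_pearson _ _ _ P _ (expR (h * x - h ^+ 2 / 2))) => //.
- exact: mpre.
- move=> w /=; rewrite in_itv /= => xw.
  by rewrite ler_expR lerD2r ler_wnM2l // ltW.
- move=> w /=; rewrite in_itv /= => /negP; rewrite -ltNge => xw.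
  by rewrite ler_expR lerD2r ler_wnM2l // ltW.
- by apply: (le_trans PEx); rewrite -PhiE -lawX.
Qed.

(** Translation by [mu] maps the set defining [Phi_inv p1] into the one defining [Phi_inv p2].
    Comparing infima also covers infinite values. *)
Lemma Phi_inv_le (R : realType) (p1 p2 mu : R) :
  (forall x, p1 <= Phi x -> p2 <= Phi (x + mu)) ->
  (Phi_inv p2 <= Phi_inv p1 + mu%:E)%E.
Proof.
move=> p12; rewrite -leeBlDr //; apply: le_ereal_inf_tmp => _ [x /= px <-].
rewrite EFinN leeBlDr // -EFinD; apply: ereal_inf_lbound.
by exists (x + mu) => //; exact: p12.
Qed.

(** * Sensitivity of the transformed group sums *)

(** For [a < b], both [s + a] and [b] lie between [a] and [s + b], with the two weights exchanged.
    Adding the two concavity inequalities gives [psi (s + a) + psi b >= psi a + psi (s + b)];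
    monotonicity fixes the signs in the absolute values. *)
Lemma neighbor_function_increment (R : realType) (psi : R -> R) (s a b : R) :
  neighbor_function psi -> 0 <= s -> 0 <= a -> 0 <= b ->
  `|psi (s + a) - psi (s + b)| <= `|psi a - psi b|.
Proof.
move=> [psi_inc _ psi_conc _] s0.
wlog ab : a b / a <= b.
  move=> H a0 b0; have [ab|/ltW ba] := leP a b; first exact: H.
  by rewrite distrC [leRHS]distrC; exact: H.
move=> a0 b0.
have [->|nab] := eqVneq a b; first by rewrite !subrr.
have {nab}ab : a < b by rewrite lt_neqAle nab.
have l1 : psi a < psi b by exact: psi_inc.
have l2 : psi (s + a) < psi (s + b) by apply: psi_inc; lra.
rewrite !ltr0_norm ?subr_lt0 //.
(* [t] is the weight of [a] in [s + a], and [1 - t] its weight in [b]. *)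
pose t := (b - a) / (b + s - a).
have den : 0 < b + s - a by lra.
have t01 : 0 <= t <= 1.
  by rewrite /t divr_ge0 ?ler_pdivrMr //=; lra.
have t01' : 0 <= 1 - t <= 1 by lra.
have sb0 : 0 <= s + b by lra.
have := psi_conc a (s + b) t a0 sb0 t01.
have := psi_conc a (s + b) (1 - t) a0 sb0 t01'.
have -> : t * a + (1 - t) * (s + b) = s + a.
  by rewrite /t; field; rewrite gt_eqF.
have -> : (1 - t) * a + (1 - (1 - t)) * (s + b) = b.
  by rewrite /t; field; rewrite gt_eqF.
lra.
Qed.

Lemma groupby_sum_cat_cons (R : realType) (Pub : Type) (m : nat) (Gr : finType)
    (G : Pub -> Gr) (i : 'I_m) (s1 s2 : dataset R Pub m) (r : record R Pub m)
    (g : Gr) :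
  groupby_sum G i (s1 ++ r :: s2) g =
  groupby_sum G i (s1 ++ s2) g + (if g == G (pub r) then conf r i else 0).
Proof.
rewrite /groupby_sum !big_cat /= big_cons eq_sym.
by case: ifP => _; rewrite ?addr0 //; ring.
Qed.

Lemma groupby_sum_ge0 (R : realType) (Pub : Type) (m : nat) (Gr : finType)
    (G : Pub -> Gr) (i : 'I_m) (D : dataset R Pub m) (g : Gr) :
  0 <= groupby_sum G i D g.
Proof. by apply: sumr_ge0 => r _; exact: conf_ge0. Qed.

(** * Privacy of the neighbor mechanism *)

Theorem theorem6p5 (R : realType) (Pub : Type) (m : nat) (psi : R -> R)
  (sigma : 'I_m -> R) (mu : R) (Gr : finType) (G : Pub -> Gr) (i : 'I_m)
  (d : measure_display) (Omega : measurableType d) (P : probability Omega R)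
  (W : Gr -> Omega -> R) :
  neighbor_function psi ->
  (forall j, 0 <= sigma j) ->
  0 < mu ->
  (forall g, measurable_fun setT (W g)) ->
  (forall g (A : set R), measurable A -> P (W g @^-1` A) = normal_prob 0 1 A) ->
  mutually_independent P W ->
  gaussian_establishment_DP P psi sigma mu
    (fun D omega g => psi (groupby_sum G i D g) + sigma i / mu * W g omega).
Proof.
move=> npsi sigma0 mu0 mW lawW indW D1 D2.
move=> [s1 [s2 [r [r' [[rpub rclose] -> ->]]]]] S mS.
set q1 := groupby_sum G i (s1 ++ r' :: s2).
set q2 := groupby_sum G i (s1 ++ r :: s2).
(* Close records share their public values, so [r] and [r'] fall in the same group [g0]. *)
pose g0 := G (pub r).
have q12 g : g != g0 -> q2 g = q1 g.
  move=> gg0; rewrite /q1 /q2 !groupby_sum_cat_cons -rpub.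
  by rewrite -/g0 (negbTE gg0).
pose delta := psi (q2 g0) - psi (q1 g0).
(* The records common to both datasets contribute the shift [s] of [neighbor_function_increment]. *)
have delta_le : `|delta| <= sigma i.
  apply: le_trans (rclose i).
  rewrite /delta /q1 /q2 !groupby_sum_cat_cons -rpub -/g0 eqxx.
  by apply: neighbor_function_increment => //;
    [exact: groupby_sum_ge0|exact: conf_ge0|exact: conf_ge0].
have psi_q2 g : psi (q2 g) = psi (q1 g) + (if g == g0 then delta else 0).
  case: eqVneq => [->|/q12 ->]; last by rewrite addr0.
  by rewrite /delta; ring.
(* When [sigma i] is zero there is no noise to rescale by, but then [delta] vanishes and both
   outputs coincide. *)
apply: Phi_inv_le => x; have [si0|si0] := eqVneq (sigma i) 0.
  have d0 : delta = 0.
    by apply/eqP; rewrite -normr_le0 -si0.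
  set p1 := fine _; set p2 := fine _.
  have -> : p2 = p1.
    congr (fine (P (_ @^-1` S))); apply/funext => w; apply/funext => g.
    by rewrite psi_q2 d0 if_same addr0.
  by move=> /le_trans; apply; apply: Phi_nondecreasing; lra.
have sigma_gt0 : 0 < sigma i by rewrite lt_neqAle eq_sym si0 sigma0.
have tau0 : 0 < sigma i / mu by rewrite divr_gt0.
set tau := sigma i / mu in tau0 *.
(* The displacement in units of the noise's standard deviation. *)
pose h := delta / tau.
have h_le : `|h| <= mu.
  rewrite /h normrM normfV (gtr0_norm tau0) ler_pdivrMr //.
  by rewrite /tau mulrC divfK // gt_eqF.
(* [phi g] turns a standard Gaussian coordinate into the output on [D1]; shifting coordinate [g0] by
   [h] first gives the output on [D2]. *)
pose phi g y := psi (q1 g) + tau * y.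
have mphi g : measurable_fun setT (phi g).
  by apply: measurable_funD => //; exact: measurable_funM.
have sS := out_measurable_rectangles _ _ _ mS.
have mE : measurable ((fun w g => phi g (W g w)) @^-1` S).
  apply: measurable_preimage_rectangles => // g.
  by apply: measurableT_comp; [exact: mphi|exact: mW].
move=> p1x.
have p2E : (fun w g => psi (q2 g) + tau * W g w) @^-1` S =
    [set w | S (fun g => phi g (W g w + (if g == g0 then h else 0)))].
  rewrite /preimage; apply/funext => w /=; congr S; apply/funext => g.
  rewrite psi_q2 /phi; case: ifP => _; last by rewrite !addr0.
  by rewrite /h; field; rewrite gt_eqF.
rewrite p2E.
rewrite (gaussian_shift_density _ _ _ P _ _ _ g0 h _ mW lawW indW mphi sS).
have := normal_tilt_le _ _ _ P (W g0) h x _ (mW g0) (lawW g0) mE p1x.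
move=> le1.
have le2 : Phi (x + `|h|) <= Phi (x + mu) by apply: Phi_nondecreasing; lra.
apply: le_trans le2; rewrite -lee_fin fineK //.
(* The integral is turned back into a probability to see that it is finite, as removing [fine]
   requires. *)
rewrite -(gaussian_shift_density _ _ _ P _ _ _ g0 h _ mW lawW indW mphi sS).
rewrite fin_num_measure // -p2E; apply: measurable_preimage_rectangles => // g.
by apply: measurable_funD => //; exact: measurable_funM.
Qed.
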